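(* If $d>0$ is a positive constant, then for all $x\in\mathbb{R}$ $$\left|\frac{1}{\sqrt{\pi d}}\sum_{n=-\infty}^{\infty} e^{-\frac{(x-n)^2}{d}}-1\right|=\left|\vartheta_3(\pi x,i\pi d)-1\right|<\operatorname{csch}(\pi^2 d).$$
   Context: The third Theta function is $\vartheta_3(z,\tau)=\sum_{n\in\mathbb{Z}} e^{2inz+\pi i n^2\tau}$, defined for $z\in\mathbb{C}$ and $\tau\in\mathbb{C}$ with $\operatorname{Im}(\tau)>0$, where $i$ is the imaginary unit. The hyperbolic cosecant is $\operatorname{csch}(t)=\frac{1}{\sinh t}=\frac{2}{e^{t}-e^{-t}}$. Here $d$ is a real number and $\sqrt{\pi d}$ denotes the positive square root. *)

(* Defs.v *)
From Stdlib Require Import Reals ZArith Lra Lia.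
From Coquelicot Require Import Coquelicot.
Open Scope R_scope.

(* Convergence of a bilateral series: both one-sided series (over n >= 0 and
   over n <= -1) converge, and the value is the sum of the two. *)
Definition is_Zseries {K : AbsRing} {V : NormedModule K} (a : Z -> V) (l : V)
  : Prop :=
  exists l1 l2 : V,
    is_series (fun k : nat => a (Z.of_nat k)) l1 /\
    is_series (fun k : nat => a (- Z.of_nat (S k))%Z) l2 /\
    l = plus l1 l2.

(* Total operators, meaningful when the series converges; this is checked below
   for the series of interest ([is_Zseries_theta3], [is_Zseries_gauss]). *)
Definition ZSeries (a : Z -> R) : R :=
  Series (fun k : nat => a (Z.of_nat k)) +
  Series (fun k : nat => a (- Z.of_nat (S k))%Z).

Definition CZSeries (a : Z -> C) : C :=
  (ZSeries (fun n => Re (a n)), ZSeries (fun n => Im (a n))).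

Definition Cexp (z : C) : C :=
  (exp (Re z) * cos (Im z), exp (Re z) * sin (Im z)).

Definition theta3_term (z tau : C) (n : Z) : C :=
  Cexp (2 * Ci * IZR n * z + PI * Ci * IZR n ^ 2 * tau)%C.

(* Only meaningful for 0 < Im tau. *)
Definition theta3 (z tau : C) : C := CZSeries (theta3_term z tau).

Definition csch (t : R) : R := / sinh t.

Lemma exp_m1_pow (k : nat) : exp (-1) ^ k = exp (-1 * INR k).
Proof.
induction k as [|k IH].
- simpl. now rewrite Rmult_0_r, exp_0.
- rewrite S_INR. simpl. rewrite IH, <- exp_plus. f_equal. ring.
Qed.

Lemma ex_series_quad (a b : R) (u : nat -> R) :
  0 < a ->
  (forall k : nat, Rabs (u k) <= exp (b * INR k - a * INR k ^ 2)) ->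
  ex_series u.
Proof.
intros ha hu.
apply (ex_series_le u
  (fun k => scal (exp ((b + 1) ^ 2 / (4 * a))) (exp (-1) ^ k))).
- intros k. change (norm (u k)) with (Rabs (u k)).
  change (scal ?p ?q) with (p * q).
  eapply Rle_trans; [apply hu|].
  rewrite exp_m1_pow, <- exp_plus.
  set (m := INR k).
  assert (H : b * m - a * m ^ 2 <= (b + 1) ^ 2 / (4 * a) + -1 * m).
  { assert (E : (b + 1) ^ 2 / (4 * a) + -1 * m - (b * m - a * m ^ 2)
                = (2 * a * m - (b + 1)) ^ 2 / (4 * a)) by (field; lra).
    assert (0 <= (2 * a * m - (b + 1)) ^ 2 / (4 * a)).
    { apply Rmult_le_pos; [apply pow2_ge_0|].
      apply Rlt_le, Rinv_0_lt_compat; lra. }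
    lra. }
  destruct H as [H|H]; [left; now apply exp_increasing|right; now rewrite H].
- apply (ex_series_scal (exp ((b + 1) ^ 2 / (4 * a))) (fun k => exp (-1) ^ k)).
  apply ex_series_geom.
  rewrite Rabs_pos_eq by apply Rlt_le, exp_pos.
  rewrite <- exp_0. apply exp_increasing. lra.
Qed.

Lemma IZR_opp_S (k : nat) : IZR (- Z.of_nat (S k)) = - INR (S k).
Proof. now rewrite opp_IZR, <- INR_IZR_INZ. Qed.

Lemma ex_series_Zquad (a b : R) (u : Z -> R) :
  0 < a ->
  (forall n : Z, Rabs (u n) <= exp (b * IZR n - a * IZR n ^ 2)) ->
  ex_series (fun k : nat => u (Z.of_nat k)) /\
  ex_series (fun k : nat => u (- Z.of_nat (S k))%Z).
Proof.
intros ha hu; split.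
- apply (ex_series_quad a b); [easy|]. intros k.
  rewrite INR_IZR_INZ. apply hu.
- assert (E : ex_series (fun k : nat => u (- Z.of_nat k)%Z)).
  { apply (ex_series_quad a (- b)); [easy|]. intros k.
    eapply Rle_trans; [apply hu|]. right. f_equal.
    rewrite opp_IZR, <- INR_IZR_INZ. ring. }
  now apply (ex_series_incr_1 (fun k : nat => u (- Z.of_nat k)%Z)).
Qed.

Lemma is_Zseries_ZSeries (u : Z -> R) :
  ex_series (fun k : nat => u (Z.of_nat k)) ->
  ex_series (fun k : nat => u (- Z.of_nat (S k))%Z) ->
  is_Zseries u (ZSeries u).
Proof.
intros h1 h2. eexists; eexists.
split; [apply (Series_correct _ h1)|split; [apply (Series_correct _ h2)|easy]].
Qed.

Lemma is_series_C (a : nat -> C) (l1 l2 : R) :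
  is_series (fun k => Re (a k)) l1 -> is_series (fun k => Im (a k)) l2 ->
  is_series a ((l1, l2) : C).
Proof.
intros h1 h2. apply filterlim_locally. intros eps.
generalize (filter_and _ _ (proj1 (filterlim_locally _ _) h1 eps)
                           (proj1 (filterlim_locally _ _) h2 eps)).
apply filter_imp. intros n [b1 b2].
assert (E : sum_n a n =
  (sum_n (fun k => Re (a k)) n, sum_n (fun k => Im (a k)) n)).
{ clear. induction n as [|n IH].
  - rewrite !sum_O. now destruct (a O).
  - rewrite !sum_Sn, IH. now destruct (a (S n)). }
change (ball ((l1, l2) : C) eps (sum_n a n)).
rewrite E. split; assumption.
Qed.

Lemma is_Zseries_CZSeries (a : Z -> C) :
  is_Zseries (fun n => Re (a n)) (ZSeries (fun n => Re (a n))) ->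
  is_Zseries (fun n => Im (a n)) (ZSeries (fun n => Im (a n))) ->
  is_Zseries a (CZSeries a).
Proof.
intros [p1 [p2 [h1 [h2 e]]]] [q1 [q2 [k1 [k2 f]]]].
exists (p1, q1), (p2, q2). split; [|split].
- now apply is_series_C.
- now apply is_series_C.
- unfold CZSeries. rewrite e, f. reflexivity.
Qed.

Lemma Re_Im_theta3_term_le (z tau : C) (n : Z) :
  Rabs (Re (theta3_term z tau n)) <=
    exp (- 2 * Im z * IZR n - PI * Im tau * IZR n ^ 2) /\
  Rabs (Im (theta3_term z tau n)) <=
    exp (- 2 * Im z * IZR n - PI * Im tau * IZR n ^ 2).
Proof.
unfold theta3_term, Cexp.
set (w := (_ + _)%C).
assert (E : Re w = - 2 * Im z * IZR n - PI * Im tau * IZR n ^ 2).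
{ unfold w. destruct z, tau. simpl. ring. }
rewrite <- E. change (Re (?p, ?q)) with p. change (Im (?p, ?q)) with q.
rewrite !Rabs_mult, !(Rabs_pos_eq (exp _)) by apply Rlt_le, exp_pos.
pose proof (exp_pos (Re w)) as H.
split; rewrite <- (Rmult_1_r (exp (Re w))) at 2;
  apply Rmult_le_compat_l; try lra; apply Rabs_le.
- apply COS_bound.
- apply SIN_bound.
Qed.

Lemma is_Zseries_theta3 (z tau : C) :
  0 < Im tau -> is_Zseries (theta3_term z tau) (theta3 z tau).
Proof.
intros ht.
assert (hp : 0 < PI * Im tau) by (apply Rmult_lt_0_compat; [apply PI_RGT_0|easy]).
apply is_Zseries_CZSeries.
- destruct (ex_series_Zquad _ _ (fun n => Re (theta3_term z tau n)) hp
    (fun n => proj1 (Re_Im_theta3_term_le z tau n))) as [h1 h2].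
  now apply is_Zseries_ZSeries.
- destruct (ex_series_Zquad _ _ (fun n => Im (theta3_term z tau n)) hp
    (fun n => proj2 (Re_Im_theta3_term_le z tau n))) as [h1 h2].
  now apply is_Zseries_ZSeries.
Qed.

Lemma is_Zseries_gauss (d x : R) :
  0 < d ->
  is_Zseries (fun n => exp (- (x - IZR n) ^ 2 / d))
             (ZSeries (fun n => exp (- (x - IZR n) ^ 2 / d))).
Proof.
intros hd.
destruct (ex_series_Zquad (/ d) (2 * x / d)
  (fun n => exp (- (x - IZR n) ^ 2 / d))) as [h1 h2].
- now apply Rinv_0_lt_compat.
- intros n. rewrite Rabs_pos_eq by apply Rlt_le, exp_pos.
  assert (H : - (x - IZR n) ^ 2 / d <= 2 * x / d * IZR n - / d * IZR n ^ 2).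
  { assert (0 <= x ^ 2 * / d).
    { apply Rmult_le_pos; [apply pow2_ge_0|].
      now apply Rlt_le, Rinv_0_lt_compat. }
    assert (2 * x / d * IZR n - / d * IZR n ^ 2 - - (x - IZR n) ^ 2 / d
            = x ^ 2 * / d) by (field; lra).
    lra. }
  destruct H as [H|H]; [left; now apply exp_increasing|right; now rewrite H].
- now apply is_Zseries_ZSeries.
Qed.

(* Main.v *)
(** Polya's proof of the theta transformation.  Averaging the expansion of
    [(2 cos t) ^ (2 m)] over the translates of [t] by the multiples of [PI / l]
    keeps only the frequencies divisible by [l]:
    [sum_j (2 cos (t + PI j / l)) ^ (2 m)
       = l sum_k binom (2 m) (m + k l) cos (2 k l t)].
    Put [t = - PI x / l] and let [m] go to infinity with [l ~ PI sqrt (d m)].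
    Suitably normalised, the left side tends to the Gaussian series and the right
    side to the theta series.  The constant is fixed by the self-dual case
    [d = 1 / PI], [x = 0].  For the estimate, compare
    [2 sum_(n >= 1) q ^ (n ^ 2)] with [2 sum_(n >= 1) q ^ (2 n - 1)] for
    [q = exp (- PI ^ 2 d)]; the latter is [csch (PI ^ 2 d)]. *)

Require Import Defs.
From Stdlib Require Import Reals ZArith Lra Lia.
From Coquelicot Require Import Coquelicot.
Open Scope R_scope.

(** * Symmetric partial sums of bilateral series *)

Fixpoint Zsum (f : Z -> R) (N : nat) : R :=
  match N with
  | O => f 0%Z
  | S N' => Zsum f N' + f (Z.of_nat (S N')) + f (- Z.of_nat (S N'))%Z
  end.

Lemma Zsum_S (f : Z -> R) (N : nat) :
  Zsum f (S N) = Zsum f N + f (Z.of_nat (S N)) + f (- Z.of_nat (S N))%Z.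
Proof. reflexivity. Qed.

Lemma Zsum_ext (f g : Z -> R) (N : nat) :
  (forall n, (Z.abs n <= Z.of_nat N)%Z -> f n = g n) -> Zsum f N = Zsum g N.
Proof.
induction N as [|N IH]; intros h.
- apply h. lia.
- rewrite !Zsum_S, IH by (intros n hn; apply h; lia). rewrite !h by lia. reflexivity.
Qed.

Lemma Zsum_zero (f : Z -> R) (N : nat) :
  (forall n, (Z.abs n <= Z.of_nat N)%Z -> f n = 0) -> Zsum f N = 0.
Proof.
intros h. rewrite (Zsum_ext f (fun _ => 0)) by exact h. clear h.
induction N as [|N IH]; [reflexivity|rewrite Zsum_S, IH; ring].
Qed.

Lemma Zsum_single (f : Z -> R) (c : Z) (N : nat) :
  (forall k, k <> c -> f k = 0) -> (Z.abs c <= Z.of_nat N)%Z -> Zsum f N = f c.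
Proof.
intros h. induction N as [|N IH]; intros hc.
- simpl. f_equal. lia.
- rewrite Zsum_S. destruct (Z_le_dec (Z.abs c) (Z.of_nat N)) as [i|i].
  + rewrite IH by exact i.
    rewrite (h (Z.of_nat (S N))), (h (- Z.of_nat (S N))%Z) by lia. ring.
  + rewrite (Zsum_zero f N) by (intros n hn; apply h; lia).
    destruct (Z_le_dec 0 c) as [j|j].
    * rewrite (h (- Z.of_nat (S N))%Z) by lia.
      replace (Z.of_nat (S N)) with c by lia. ring.
    * rewrite (h (Z.of_nat (S N))) by lia.
      replace (- Z.of_nat (S N))%Z with c by lia. ring.
Qed.

Lemma Zsum_scal (c : R) (f : Z -> R) (N : nat) :
  Zsum (fun n => c * f n) N = c * Zsum f N.
Proof. induction N as [|N IH]; [easy|rewrite !Zsum_S, IH; ring]. Qed.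

Lemma Zsum_const (c : R) (N : nat) : Zsum (fun _ => c) N = INR (2 * N + 1) * c.
Proof.
induction N as [|N IH]; [simpl; ring|rewrite Zsum_S, IH].
replace (2 * S N + 1)%nat with (S (S (2 * N + 1))) by lia.
rewrite !S_INR. ring.
Qed.

Lemma Zsum_odd (f : Z -> R) (N : nat) :
  (forall n, f (- n)%Z = - f n) -> Zsum f N = 0.
Proof.
intros h. induction N as [|N IH].
- specialize (h 0%Z). simpl in h |- *. lra.
- rewrite Zsum_S, IH, h. ring.
Qed.

Lemma is_lim_seq_Zsum (f : Z -> R) :
  ex_series (fun k : nat => f (Z.of_nat k)) ->
  ex_series (fun k : nat => f (- Z.of_nat (S k))%Z) ->
  is_lim_seq (Zsum f) (ZSeries f).
Proof.
intros h1 h2. apply is_lim_seq_incr_1.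
(* The negative half starts at [-1], so [N + 1] of its terms match the nonnegative indices up to
   [S N]; hence the shift by one. *)
apply is_lim_seq_ext with (fun N =>
  sum_n (fun k => f (Z.of_nat k)) (S N) + sum_n (fun k => f (- Z.of_nat (S k))%Z) N).
- induction n as [|n IH].
  + rewrite sum_Sn, !sum_O. reflexivity.
  + rewrite (Zsum_S f (S n)), <- IH, (sum_Sn _ (S n)).
    rewrite (sum_Sn (fun k => f (- Z.of_nat (S k))%Z) n).
    repeat match goal with |- context [plus ?p ?q] =>
      change (plus p q) with (p + q) end. ring.
- apply is_lim_seq_plus'.
  + apply (is_lim_seq_incr_1 (sum_n (fun k => f (Z.of_nat k)))).
    exact (Series_correct _ h1).
  + exact (Series_correct _ h2).
Qed.

Lemma is_lim_seq_Zsum_pointwise (a : nat -> Z -> R) (A : Z -> R) (N : nat) :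
  (forall n, is_lim_seq (fun m => a m n) (A n)) ->
  is_lim_seq (fun m => Zsum (a m) N) (Zsum A N).
Proof.
intros h. induction N as [|N IH].
- apply h.
- simpl Zsum. repeat apply is_lim_seq_plus'; auto.
Qed.

Lemma Zsum_tail_le (f b : Z -> R) (N k : nat) :
  (forall n, (Z.abs n <= Z.of_nat (N + k))%Z -> Rabs (f n) <= b n) ->
  Rabs (Zsum f (N + k) - Zsum f N) <= Zsum b (N + k) - Zsum b N.
Proof.
induction k as [|k IH]; intros h.
- rewrite Nat.add_0_r, !Rminus_diag, Rabs_R0. lra.
- rewrite Nat.add_succ_r in h |- *. rewrite !Zsum_S.
  assert (h1 := IH ltac:(intros n hn; apply h; lia)).
  assert (h2 := h (Z.of_nat (S (N + k))) ltac:(lia)).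
  assert (h3 := h (- Z.of_nat (S (N + k)))%Z ltac:(lia)).
  apply Rabs_le_between in h1, h2, h3. apply Rabs_le_between. lra.
Qed.

(** Tannery's theorem, that is, dominated convergence for sums whose range [p m] grows with [m].
    Beyond a fixed [N] the terms are controlled by the tail of [b]; up to [N] the sum is finite and
    converges termwise. *)
Lemma Zsum_Tannery (a : nat -> Z -> R) (A b : Z -> R) (la lb : R) (p : nat -> nat) :
  is_lim_seq (Zsum A) la -> is_lim_seq (Zsum b) lb ->
  (forall N, eventually (fun m => (N <= p m)%nat)) ->
  eventually (fun m => forall n, (Z.abs n <= Z.of_nat (p m))%Z -> Rabs (a m n) <= b n) ->
  (forall n, is_lim_seq (fun m => a m n) (A n)) ->
  is_lim_seq (fun m => Zsum (a m) (p m)) la.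
Proof.
intros hA hb hp hd hl. apply is_lim_seq_spec. intros eps.
(* The error stays below four times [e]: one for the finite part, one for the distance of [Zsum A N]
   from [la], and two for the tail of [b]. *)
assert (he : 0 < eps / 5) by (destruct eps; simpl; lra).
set (e := mkposreal _ he).
apply is_lim_seq_spec in hA, hb.
destruct (filter_and (F := eventually) _ _ (hA e) (hb e)) as [N hN].
destruct (hN N (le_n N)) as [hA1 _].
assert (hf := is_lim_seq_Zsum_pointwise a A N hl).
apply is_lim_seq_spec in hf.
generalize (filter_and (F := eventually) _ _ (hf e) (filter_and _ _ hd (hp N))).
apply filter_imp. intros m [h1 [h2 h3]].
destruct (hN N (le_n N)) as [_ hb1]. destruct (hN (p m) h3) as [_ hb2].
assert (ht : Rabs (Zsum (a m) (p m) - Zsum (a m) N) <= Zsum b (p m) - Zsum b N).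
{ replace (p m) with (N + (p m - N))%nat by lia. apply Zsum_tail_le.
  replace (N + (p m - N))%nat with (p m) by lia. exact h2. }
simpl in *.
apply Rabs_le_between in ht. apply Rabs_lt_between in hA1, h1, hb1, hb2.
apply Rabs_lt_between. lra.
Qed.

(** * Binomial weights and the expansion of even powers of the cosine *)

(** [walk m g] is the sum over [n] of [bw m n * g n], where [bw m n] (below) is
    the binomial coefficient of [2 m] over [m + n]. *)
Fixpoint walk (m : nat) (g : Z -> R) : R :=
  match m with
  | O => g 0%Z
  | S m' => walk m' (fun n => g (n - 1)%Z + 2 * g n + g (n + 1)%Z)
  end.

Definition ind (k n : Z) : R := if Z.eqb n k then 1 else 0.

Definition bw (m : nat) (k : Z) : R := walk m (ind k).

Lemma walk_ext (m : nat) (g h : Z -> R) :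
  (forall n, (Z.abs n <= Z.of_nat m)%Z -> g n = h n) -> walk m g = walk m h.
Proof.
revert g h. induction m as [|m IH]; intros g h e; simpl walk.
- apply e. lia.
- apply IH. intros n hn. rewrite !e by lia. reflexivity.
Qed.

Lemma walk_plus (m : nat) (g h : Z -> R) :
  walk m (fun n => g n + h n) = walk m g + walk m h.
Proof.
revert g h. induction m as [|m IH]; intros g h; simpl walk; [easy|].
rewrite <- IH. apply walk_ext. intros; ring.
Qed.

Lemma walk_scal (m : nat) (c : R) (g : Z -> R) :
  walk m (fun n => c * g n) = c * walk m g.
Proof.
revert g. induction m as [|m IH]; intros g; simpl walk; [easy|].
rewrite <- IH. apply walk_ext. intros; ring.
Qed.

Lemma walk_Zsum (m p : nat) (F : Z -> Z -> R) :
  walk m (fun n => Zsum (fun j => F j n) p) = Zsum (fun j => walk m (F j)) p.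
Proof.
induction p as [|p IH]; [easy|].
simpl Zsum. rewrite !walk_plus, IH. reflexivity.
Qed.

(** The cosine is an eigenfunction of one step of [walk], with eigenvalue
    [2 + 2 cos (2 t) = (2 cos t)^2]. *)
Lemma walk_cos (m : nat) (t : R) :
  walk m (fun n => cos (2 * IZR n * t)) = (2 * cos t) ^ (2 * m).
Proof.
induction m as [|m IH].
- simpl. rewrite Rmult_0_r, Rmult_0_l, cos_0. reflexivity.
- replace (2 * S m)%nat with (2 + 2 * m)%nat by lia.
  rewrite pow_add, <- IH, <- walk_scal. simpl walk. apply walk_ext. intros n _.
  rewrite minus_IZR, plus_IZR.
  replace (2 * (IZR n - 1) * t) with (2 * IZR n * t - 2 * t) by ring.
  replace (2 * (IZR n + 1) * t) with (2 * IZR n * t + 2 * t) by ring.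
  rewrite cos_minus, cos_plus, (cos_2a_cos t). ring.
Qed.

Lemma bw_O (k : Z) : bw 0 k = if Z.eqb 0 k then 1 else 0.
Proof. reflexivity. Qed.

Lemma bw_S (m : nat) (k : Z) :
  bw (S m) k = bw m (k - 1) + 2 * bw m k + bw m (k + 1).
Proof.
unfold bw. simpl walk. rewrite <- walk_scal, <- !walk_plus.
apply walk_ext. intros n _. unfold ind.
destruct (Z.eqb_spec (n - 1) k), (Z.eqb_spec n k), (Z.eqb_spec (n + 1) k),
  (Z.eqb_spec n (k - 1)), (Z.eqb_spec n (k + 1)); try lia; ring.
Qed.

(** Multiplying out the ratio of neighbouring binomial coefficients keeps the relation valid for
    every integer [k], also outside the support. The inductive step is then a linear combination of
    the hypothesis at [k - 1], [k] and [k + 1]. *)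
Lemma bw_step (m : nat) (k : Z) :
  (INR m + IZR k + 1) * bw m (k + 1) = (INR m - IZR k) * bw m k.
Proof.
revert k. induction m as [|m IH]; intros k.
- rewrite !bw_O. simpl INR.
  destruct (Z.eqb_spec 0 (k + 1)), (Z.eqb_spec 0 k); try lia.
  + replace k with (-1)%Z by lia. ring.
  + subst k. ring.
  + ring.
- rewrite !bw_S, S_INR.
  assert (h0 := IH k). assert (h1 := IH (k + 1)%Z). assert (h2 := IH (k - 1)%Z).
  replace (k - 1 + 1)%Z with k in h2 by ring.
  replace (k + 1 - 1)%Z with k by ring.
  rewrite plus_IZR in h1. rewrite minus_IZR in h2. lra.
Qed.

Lemma bw_opp (m : nat) (k : Z) : bw m (- k) = bw m k.
Proof.
revert k. induction m as [|m IH]; intros k.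
- rewrite !bw_O.
  destruct (Z.eqb_spec 0 (- k)), (Z.eqb_spec 0 k); try lia; reflexivity.
- rewrite !bw_S. replace (- k - 1)%Z with (- (k + 1))%Z by ring.
  replace (- k + 1)%Z with (- (k - 1))%Z by ring. rewrite !IH. ring.
Qed.

Lemma bw_ge_0 (m : nat) (k : Z) : 0 <= bw m k.
Proof.
revert k. induction m as [|m IH]; intros k.
- rewrite bw_O. destruct (Z.eqb 0 k); lra.
- rewrite bw_S. assert (h1 := IH k). assert (h2 := IH (k - 1)%Z).
  assert (h3 := IH (k + 1)%Z). lra.
Qed.

Lemma bw_0_gt_0 (m : nat) : 0 < bw m 0.
Proof.
induction m as [|m IH].
- rewrite bw_O. simpl. lra.
- rewrite bw_S. assert (h2 := bw_ge_0 m (0 - 1)). assert (h3 := bw_ge_0 m (0 + 1)).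
  lra.
Qed.

(** On [|n| <= m], which is all that [walk m] sees, [h] is the sum of the point masses
    [h (k l) * ind (k l)]. Since [l >= 1], the range [|k| <= m] catches every multiple. *)
Lemma walk_multiples (m : nat) (l : Z) (h : Z -> R) :
  (0 < l)%Z -> (forall n, ~ (l | n)%Z -> h n = 0) ->
  walk m h = Zsum (fun k => bw m (k * l) * h (k * l)%Z) m.
Proof.
intros hl h0.
rewrite (Zsum_ext _ (fun k => walk m (fun n => h (k * l)%Z * ind (k * l) n)))
  by (intros; rewrite walk_scal; apply Rmult_comm).
rewrite <- walk_Zsum. apply walk_ext. intros n hn.
destruct (Znumtheory.Zdivide_dec l n) as [[c e]|i].
- subst n. rewrite (Zsum_single _ c).
  + unfold ind. rewrite Z.eqb_refl. ring.
  + intros k hk. unfold ind.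
    destruct (Z.eqb_spec (c * l) (k * l)); [nia|ring].
  + nia.
- rewrite h0 by exact i. symmetry. apply Zsum_zero. intros k _. unfold ind.
  destruct (Z.eqb_spec n (k * l)) as [e|_]; [|ring].
  exfalso. apply i. now exists k.
Qed.

(** * Averaging over equally spaced translates *)

(** Dirichlet kernel. The sum telescopes: with [c = j a], the pair [j], [-j] contributes [cos b *
    (sin (c + a / 2) - sin (c - a / 2))] after multiplication by [sin (a / 2)]. *)
Lemma Zsum_cos_Dirichlet (a b : R) (p : nat) :
  sin (a / 2) * Zsum (fun j => cos (b + IZR j * a)) p =
  cos b * sin (INR (2 * p + 1) * (a / 2)).
Proof.
induction p as [|p IH].
- simpl. rewrite Rmult_0_l, Rplus_0_r, Rmult_1_l. ring.
- rewrite Zsum_S, !Rmult_plus_distr_l, IH.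
  rewrite IZR_opp_S, <- INR_IZR_INZ.
  replace (2 * S p + 1)%nat with (S (S (2 * p + 1))) by lia.
  rewrite !S_INR.
  set (c := (INR p + 1) * a).
  replace (INR (2 * p + 1)) with (2 * INR p + 1)
    by (rewrite plus_INR, mult_INR; simpl; ring).
  replace ((2 * INR p + 1) * (a / 2)) with (c - a / 2) by (unfold c; field).
  replace ((2 * INR p + 1 + 1 + 1) * (a / 2)) with (c + a / 2) by (unfold c; field).
  replace (b + - (INR p + 1) * a) with (b - c) by (unfold c; ring).
  rewrite !cos_plus, !cos_minus, sin_plus, sin_minus. ring.
Qed.

Lemma cos_add_IZR_2PI (b : R) (k : Z) : cos (b + IZR k * (2 * PI)) = cos b.
Proof.
assert (h : sin (IZR k * PI) = 0) by (apply sin_eq_0_1; now exists k).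
replace (IZR k * (2 * PI)) with (2 * (IZR k * PI)) by ring.
rewrite cos_plus, cos_2a_sin, sin_2a, h. ring.
Qed.

(** Orthogonality of the [l]-th roots of unity; odd [l] lets [j] run symmetrically around 0. If [l]
    divides [n], all terms agree up to full turns. Otherwise [sin (n PI / l)] is nonzero, while the
    Dirichlet numerator contains [sin (n PI) = 0]. *)
Lemma Zsum_cos_roots (t : R) (p : nat) (n : Z) :
  let l := Z.of_nat (2 * p + 1) in
  Zsum (fun j => cos (2 * IZR n * (t + PI * IZR j / IZR l))) p =
  if Znumtheory.Zdivide_dec l n then IZR l * cos (2 * IZR n * t) else 0.
Proof.
intros l.
assert (hl : IZR l <> 0) by (apply not_0_IZR; unfold l; lia).
rewrite (Zsum_ext _ (fun j => cos (2 * IZR n * t + IZR j * (2 * (IZR n * PI / IZR l)))))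
  by (intros; f_equal; field; exact hl).
destruct (Znumtheory.Zdivide_dec l n) as [[c e]|i].
- subst n. rewrite (Zsum_ext _ (fun _ => cos (2 * IZR (c * l) * t))).
  + rewrite Zsum_const, INR_IZR_INZ. reflexivity.
  + intros j _. rewrite <- (cos_add_IZR_2PI (2 * IZR (c * l) * t) (j * c)). f_equal.
    rewrite !mult_IZR. field. exact hl.
- apply (Rmult_eq_reg_l (sin (IZR n * PI / IZR l))).
  + replace (IZR n * PI / IZR l) with (2 * (IZR n * PI / IZR l) / 2) at 1 by (field; exact hl).
    rewrite Zsum_cos_Dirichlet, INR_IZR_INZ. fold l.
    replace (IZR l * _) with (IZR n * PI) by (field; exact hl).
    rewrite (sin_eq_0_1 (IZR n * PI)) by now exists n. ring.
  + intros h. apply sin_eq_0_0 in h. destruct h as [k hk]. apply i. exists k.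
    apply eq_IZR. rewrite mult_IZR. apply (Rmult_eq_reg_r PI); [|apply PI_neq0].
    replace (IZR k * IZR l * PI) with (IZR k * PI * IZR l) by ring.
    rewrite <- hk. field. exact hl.
Qed.

Lemma Zsum_cos_pow (t : R) (p m : nat) :
  let l := Z.of_nat (2 * p + 1) in
  Zsum (fun j => (2 * cos (t + PI * IZR j / IZR l)) ^ (2 * m)) p =
  IZR l * Zsum (fun k => bw m (k * l) * cos (2 * IZR (k * l) * t)) m.
Proof.
intros l.
rewrite (Zsum_ext _ (fun j =>
  walk m (fun n => cos (2 * IZR n * (t + PI * IZR j / IZR l)))))
  by (intros; now rewrite walk_cos).
rewrite <- walk_Zsum.
rewrite (walk_multiples m l) by
  (try (unfold l; lia); intros n hn; unfold l in *; rewrite Zsum_cos_roots;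
   now destruct (Znumtheory.Zdivide_dec _ n)).
rewrite <- Zsum_scal. apply Zsum_ext. intros k _.
unfold l. rewrite Zsum_cos_roots. fold l.
destruct (Znumtheory.Zdivide_dec l (k * l)) as [_|i]; [ring|].
exfalso. apply i. now exists k.
Qed.

(** * Gaussian bounds for ratios of binomial coefficients *)

Lemma exp_ge_1_add (u : R) : 1 + u <= exp u.
Proof.
destruct (Req_dec u 0) as [e|e].
- subst u. rewrite exp_0. lra.
- left. now apply exp_ineq1.
Qed.

(** Reciprocal of [1 + u <= exp u] at [u = v / (1 - v)], where [1 + u = 1 / (1 - v)]. *)
Lemma exp_opp_div_le (v : R) : v < 1 -> exp (- (v / (1 - v))) <= 1 - v.
Proof.
intros hv. rewrite exp_Ropp.
replace (1 - v) with (/ (1 + v / (1 - v))) at 2 by (field; lra).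
apply Rinv_le_contravar; [|apply exp_ge_1_add].
replace (1 + v / (1 - v)) with (/ (1 - v)) by (field; lra).
apply Rinv_0_lt_compat. lra.
Qed.

Lemma exp_le (u v : R) : u <= v -> exp u <= exp v.
Proof. intros [h|h]; [left; now apply exp_increasing|right; now rewrite h]. Qed.

Lemma exp_pow (u : R) (m : nat) : exp u ^ m = exp (INR m * u).
Proof.
induction m as [|m IH].
- simpl. rewrite Rmult_0_l, exp_0. reflexivity.
- rewrite S_INR. simpl pow. rewrite IH, <- exp_plus. f_equal. ring.
Qed.

(** Dividing by the central coefficient separates the Gaussian shape from the overall size, which is
    left to [wallis]. *)
Definition bwr (m : nat) (k : Z) : R := bw m k / bw m 0.

Lemma bwr_step (m n : nat) :
  bwr m (Z.of_nat (S n)) =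
  (INR m - INR n) / (INR m + INR n + 1) * bwr m (Z.of_nat n).
Proof.
assert (h := bw_step m (Z.of_nat n)). assert (h0 := bw_0_gt_0 m).
rewrite <- INR_IZR_INZ in h.
replace (Z.of_nat n + 1)%Z with (Z.of_nat (S n)) in h by lia.
assert (hm := pos_INR m). assert (hn := pos_INR n).
unfold bwr. apply (Rmult_eq_reg_l ((INR m + INR n + 1) * bw m 0)); [|nra].
transitivity ((INR m + INR n + 1) * bw m (Z.of_nat (S n))); [field; lra|].
rewrite h. field. lra.
Qed.

Lemma bwr_0 (m : nat) : bwr m 0 = 1.
Proof. unfold bwr. field. apply Rgt_not_eq, bw_0_gt_0. Qed.

Lemma bwr_ge_0 (m : nat) (k : Z) : 0 <= bwr m k.
Proof.
apply Rmult_le_pos; [apply bw_ge_0|]. apply Rlt_le, Rinv_0_lt_compat, bw_0_gt_0.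
Qed.

Lemma bwr_abs (m : nat) (k : Z) : bwr m k = bwr m (Z.of_nat (Z.abs_nat k)).
Proof.
unfold bwr. rewrite Zabs2Nat.id_abs.
destruct (Z.abs_spec k) as [[_ e]|[_ e]]; rewrite e; [easy|now rewrite bw_opp].
Qed.

(** By [bwr_step] this is a product of factors [1 - (2 i + 1) / (m + i + 1)] for [i < n], each at
    most [exp (- (2 i + 1) / N)] because the largest denominator is [m + n]. The odd numbers add up
    to [n^2]. *)
Lemma bwr_le (m n : nat) (N : R) :
  0 < N -> (n <= m)%nat -> INR m + INR n <= N ->
  bwr m (Z.of_nat n) <= exp (- (INR n ^ 2 / N)).
Proof.
intros hN. induction n as [|n IH]; intros hn h.
- simpl Z.of_nat. rewrite bwr_0. simpl. unfold Rdiv.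
  rewrite !Rmult_0_l, Ropp_0, exp_0. lra.
- rewrite bwr_step. apply le_INR in hn as hn'. rewrite S_INR in h, hn' |- *.
  assert (hm := pos_INR m). assert (hp := pos_INR n).
  replace (- ((INR n + 1) ^ 2 / N))
    with (- ((2 * INR n + 1) / N) + - (INR n ^ 2 / N)) by (field; lra).
  rewrite exp_plus. apply Rmult_le_compat.
  + apply Rmult_le_pos; [lra|]. apply Rlt_le, Rinv_0_lt_compat. lra.
  + apply bwr_ge_0.
  + eapply Rle_trans; [|apply exp_ge_1_add].
    replace ((INR m - INR n) / (INR m + INR n + 1))
      with (1 + - ((2 * INR n + 1) / (INR m + INR n + 1))) by (field; lra).
    apply Rplus_le_compat_l, Ropp_le_contravar, Rmult_le_compat_l; [lra|].
    apply Rinv_le_contravar; lra.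
  + apply IH; [lia|lra].
Qed.

(** Same product, with each factor written as the inverse of [1 + (2 i + 1) / (m - i)]; the
    hypothesis puts [D] below the smallest denominator [m - n + 1]. *)
Lemma bwr_ge (m n : nat) (D : R) :
  0 < D -> D + INR n <= INR m + 1 ->
  exp (- (INR n ^ 2 / D)) <= bwr m (Z.of_nat n).
Proof.
intros hD. induction n as [|n IH]; intros h.
- simpl Z.of_nat. rewrite bwr_0. simpl. unfold Rdiv.
  rewrite !Rmult_0_l, Ropp_0, exp_0. lra.
- rewrite bwr_step. rewrite S_INR in h |- *.
  assert (hm := pos_INR m). assert (hp := pos_INR n).
  replace (- ((INR n + 1) ^ 2 / D))
    with (- ((2 * INR n + 1) / D) + - (INR n ^ 2 / D)) by (field; lra).
  rewrite exp_plus. apply Rmult_le_compat; try (apply Rlt_le, exp_pos).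
  + rewrite exp_Ropp.
    replace ((INR m - INR n) / (INR m + INR n + 1))
      with (/ (1 + (2 * INR n + 1) / (INR m - INR n))) by (field; lra).
    apply Rinv_le_contravar.
    * replace (1 + _) with ((INR m + INR n + 1) / (INR m - INR n)) by (field; lra).
      apply Rdiv_lt_0_compat; lra.
    * eapply Rle_trans; [|apply exp_ge_1_add].
      apply Rplus_le_compat_l, Rmult_le_compat_l; [lra|].
      apply Rinv_le_contravar; lra.
  + apply IH. lra.
Qed.

Lemma bwr_eq_0 (m n : nat) : (m < n)%nat -> bwr m (Z.of_nat n) = 0.
Proof.
induction n as [|n IH]; intros h; [lia|]. rewrite bwr_step.
destruct (Nat.eq_dec m n) as [e|e].
- subst n. unfold Rdiv. rewrite Rminus_diag. ring.
- rewrite IH by lia. ring.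
Qed.

Lemma bwr_le_gauss (m : nat) (k : Z) :
  (0 < m)%nat -> bwr m k <= exp (- (IZR k ^ 2 / (2 * INR m))).
Proof.
intros hm. apply lt_0_INR in hm as hm'.
rewrite bwr_abs. rewrite <- (pow2_abs (IZR k)), <- abs_IZR, <- Zabs2Nat.id_abs.
rewrite <- INR_IZR_INZ. set (n := Z.abs_nat k).
destruct (le_lt_dec n m) as [h|h].
- apply bwr_le; try lra; try easy. apply le_INR in h. lra.
- rewrite bwr_eq_0 by exact h. apply Rlt_le, exp_pos.
Qed.

(** * Gaussian bounds for even powers of the cosine *)

(** Square of the Taylor bound [v - v^3 / 6 <= sin v]; the condition [v^2 <= 6] keeps the left side
    nonnegative. *)
Lemma sin_sq_ge (u : R) : u ^ 2 <= 6 -> u ^ 2 * (1 - u ^ 2 / 6) ^ 2 <= sin u ^ 2.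
Proof.
assert (P : forall v, 0 <= v -> v ^ 2 <= 6 -> v ^ 2 * (1 - v ^ 2 / 6) ^ 2 <= sin v ^ 2).
{ intros v h0 h6.
  destruct (pre_sin_bound v 0 h0 ltac:(nra)) as [h _].
  unfold sin_approx, sin_term in h. simpl in h.
  replace (v ^ 2 * (1 - v ^ 2 / 6) ^ 2) with ((v * (1 - v ^ 2 / 6)) ^ 2) by ring.
  apply pow_incr. split; [apply Rmult_le_pos; lra|]. lra. }
intros h. destruct (Rle_lt_dec 0 u) as [i|i]; [now apply P|].
generalize (P (- u) ltac:(lra) ltac:(lra)). rewrite sin_neg.
replace ((- u) ^ 2) with (u ^ 2) by ring. intros; lra.
Qed.

Lemma sin_sq_le (u : R) : sin u ^ 2 <= u ^ 2.
Proof.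
assert (P : forall v, 0 <= v -> sin v ^ 2 <= v ^ 2).
{ intros v [h|h].
  - destruct (Rle_lt_dec v 1) as [i|i].
    + apply pow_incr. split; [apply sin_ge_0; [lra|]|].
      * assert (h1 := PI2_1). lra.
      * left. now apply sin_lt_x.
    + assert (h1 := SIN_bound v). nra.
  - subst v. rewrite sin_0. lra. }
destruct (Rle_lt_dec 0 u) as [i|i]; [now apply P|].
generalize (P (- u) ltac:(lra)). rewrite sin_neg. intros; lra.
Qed.

Lemma cos_sq (u : R) : cos u ^ 2 = 1 - sin u ^ 2.
Proof. assert (h := sin2_cos2 u). unfold Rsqr in h. simpl. lra. Qed.

(** Writing the power as [(1 - sin^2)^m] makes the sign of the cosine harmless, so the bound reaches
    past [PI / 2], as the domination in [is_lim_cos_side] requires. *)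
Lemma cos_pow_le (u : R) (m : nat) :
  u ^ 2 <= 6 -> cos u ^ (2 * m) <= exp (- (INR m * u ^ 2 * (1 - u ^ 2 / 6) ^ 2)).
Proof.
intros h. rewrite pow_mult, cos_sq.
replace (- (INR m * u ^ 2 * (1 - u ^ 2 / 6) ^ 2))
  with (INR m * - (u ^ 2 * (1 - u ^ 2 / 6) ^ 2)) by ring.
rewrite <- exp_pow. apply pow_incr. split.
- rewrite <- cos_sq. apply pow2_ge_0.
- eapply Rle_trans; [|apply exp_ge_1_add]. assert (h1 := sin_sq_ge u h). lra.
Qed.

Lemma cos_pow_ge (u : R) (m : nat) :
  u ^ 2 < 1 -> exp (- (INR m * u ^ 2 / (1 - u ^ 2))) <= cos u ^ (2 * m).
Proof.
intros h. rewrite pow_mult, cos_sq.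
replace (- (INR m * u ^ 2 / (1 - u ^ 2)))
  with (INR m * - (u ^ 2 / (1 - u ^ 2))) by (field; lra).
rewrite <- exp_pow. apply pow_incr. split; [apply Rlt_le, exp_pos|].
eapply Rle_trans; [apply exp_opp_div_le; exact h|].
assert (h1 := sin_sq_le u). lra.
Qed.

(** * Termwise limits *)

Lemma is_lim_seq_exp (u : nat -> R) (c : R) :
  is_lim_seq u c -> is_lim_seq (fun m => exp (u m)) (exp c).
Proof.
apply is_lim_seq_continuous. apply derivable_continuous_pt, derivable_pt_exp.
Qed.

Lemma eventually_lt (u : nat -> R) (l c : R) :
  is_lim_seq u l -> l < c -> eventually (fun m => u m < c).
Proof.
intros h hc. apply is_lim_seq_spec in h.
assert (he : 0 < c - l) by lra.
generalize (h (mkposreal _ he)). apply filter_imp. simpl. intros m hm.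
apply Rabs_lt_between in hm. lra.
Qed.

Lemma eventually_gt (u : nat -> R) (l c : R) :
  is_lim_seq u l -> c < l -> eventually (fun m => c < u m).
Proof.
intros h hc. apply is_lim_seq_spec in h.
assert (he : 0 < l - c) by lra.
generalize (h (mkposreal _ he)). apply filter_imp. simpl. intros m hm.
apply Rabs_lt_between in hm. lra.
Qed.

Lemma eventually_ge (N : nat) : eventually (fun m => (N <= m)%nat).
Proof. now exists N. Qed.

Lemma is_lim_seq_sq (u : nat -> R) (l : R) :
  is_lim_seq u l -> is_lim_seq (fun m => u m ^ 2) (l ^ 2).
Proof.
apply (is_lim_seq_continuous (fun v => v ^ 2)).
apply derivable_continuous_pt, derivable_pt_pow.
Qed.

Lemma is_lim_cos_pow (t : nat -> R) (c : R) :
  is_lim_seq t 0 -> is_lim_seq (fun m => INR m * t m ^ 2) c ->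
  is_lim_seq (fun m => cos (t m) ^ (2 * m)) (exp (- c)).
Proof.
intros ht hc. apply is_lim_seq_sq in ht. rewrite pow_i in ht by lia.
apply is_lim_seq_le_le_loc with
  (fun m => exp (- (INR m * t m ^ 2 / (1 - t m ^ 2))))
  (fun m => exp (- (INR m * t m ^ 2 * (1 - t m ^ 2 / 6) ^ 2))).
- generalize (eventually_lt _ _ 1 ht ltac:(lra)). apply filter_imp. intros m hm.
  split; [now apply cos_pow_ge|apply cos_pow_le; lra].
- apply is_lim_seq_exp. replace (- c) with (- (c / (1 - 0))) by field.
  apply (is_lim_seq_opp _ (c / (1 - 0))). apply is_lim_seq_div'; try lra; try easy.
  apply is_lim_seq_minus'; [apply is_lim_seq_const|exact ht].
- apply is_lim_seq_exp. replace (- c) with (- (c * (1 - 0 / 6) ^ 2)) by field.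
  apply (is_lim_seq_opp _ (c * (1 - 0 / 6) ^ 2)). apply is_lim_seq_mult'; [easy|].
  apply is_lim_seq_sq. apply is_lim_seq_minus'; [apply is_lim_seq_const|].
  apply is_lim_seq_div'; try lra; try easy. apply is_lim_seq_const.
Qed.

(** Squeeze between [bwr_ge] with [D = m - n] and [bwr_le] with [N = m + n]: both exponents are
    [n^2 / m] over a factor that tends to 1. *)
Lemma is_lim_bwr (n : nat -> nat) (c : R) :
  is_lim_seq (fun m => INR (n m) / INR m) 0 ->
  is_lim_seq (fun m => INR (n m) ^ 2 / INR m) c ->
  is_lim_seq (fun m => bwr m (Z.of_nat (n m))) (exp (- c)).
Proof.
intros hn hc.
apply is_lim_seq_le_le_loc with
  (fun m => exp (- (INR (n m) ^ 2 / INR m / (1 - INR (n m) / INR m))))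
  (fun m => exp (- (INR (n m) ^ 2 / INR m / (1 + INR (n m) / INR m)))).
- generalize (filter_and (F := eventually) _ _ (eventually_lt _ _ 1 hn ltac:(lra)) (eventually_ge 1)).
  apply filter_imp. intros m [h1 hm].
  apply le_INR in hm. simpl in hm. assert (hp := pos_INR (n m)).
  assert (h2 : INR (n m) < INR m).
  { apply (Rmult_lt_reg_r (/ INR m)); [apply Rinv_0_lt_compat; lra|].
    rewrite Rinv_r by lra. exact h1. }
  split.
  + replace (INR (n m) ^ 2 / INR m / (1 - INR (n m) / INR m))
      with (INR (n m) ^ 2 / (INR m - INR (n m))) by (field; lra).
    apply bwr_ge; lra.
  + replace (INR (n m) ^ 2 / INR m / (1 + INR (n m) / INR m))
      with (INR (n m) ^ 2 / (INR m + INR (n m))) by (field; lra).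
    apply bwr_le; try lra. apply INR_le. lra.
- apply is_lim_seq_exp. replace (- c) with (- (c / (1 - 0))) by field.
  apply (is_lim_seq_opp _ (c / (1 - 0))). apply is_lim_seq_div'; try lra; try easy.
  apply is_lim_seq_minus'; [apply is_lim_seq_const|exact hn].
- apply is_lim_seq_exp. replace (- c) with (- (c / (1 + 0))) by field.
  apply (is_lim_seq_opp _ (c / (1 + 0))). apply is_lim_seq_div'; try lra; try easy.
  apply is_lim_seq_plus'; [apply is_lim_seq_const|exact hn].
Qed.

Lemma is_lim_inv_sqrt : is_lim_seq (fun m => / sqrt (INR m)) 0.
Proof.
replace (Finite 0) with (Rbar_inv p_infty) by reflexivity.
apply is_lim_seq_inv; [|easy].
apply (is_lim_comp_seq sqrt INR p_infty p_infty).
- exact filterlim_sqrt_p.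
- exists 0%nat. easy.
- exact is_lim_seq_INR.
Qed.

Lemma odd_approx (s : R) :
  0 < s -> exists p : nat -> nat,
  is_lim_seq (fun m => INR (2 * p m + 1) / sqrt (INR m)) s.
Proof.
(* With this floor, the odd number [2 p + 1] is within 1 of [s * sqrt m]. *)
intros hs. exists (fun m => Z.to_nat (Int_part (s * sqrt (INR m) / 2))).
apply is_lim_seq_le_le_loc with
  (fun m => s - / sqrt (INR m)) (fun m => s + / sqrt (INR m)).
- generalize (eventually_ge 1). apply filter_imp. intros m hm.
  assert (h : 0 < sqrt (INR m)) by (apply sqrt_lt_R0, lt_0_INR; lia).
  set (r := sqrt (INR m)) in *.
  destruct (base_Int_part (s * r / 2)) as [h1 h2].
  set (k := Int_part (s * r / 2)) in *.
  assert (hk : (0 <= k)%Z).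
  { apply Z.lt_succ_r, lt_IZR. rewrite succ_IZR. nra. }
  rewrite plus_INR, mult_INR, INR_IZR_INZ, (INR_IZR_INZ (Z.to_nat k)), Z2Nat.id by exact hk.
  simpl (IZR (Z.of_nat 2)). simpl (INR 1).
  replace (s - / r) with ((s * r - 1) / r) by (field; lra).
  replace (s + / r) with ((s * r + 1) / r) by (field; lra).
  split; apply Rmult_le_compat_r; try lra; apply Rlt_le, Rinv_0_lt_compat, h.
- replace s with (s - 0) at 1 by ring.
  apply is_lim_seq_minus'; [apply is_lim_seq_const|apply is_lim_inv_sqrt].
- replace s with (s + 0) at 1 by ring.
  apply is_lim_seq_plus'; [apply is_lim_seq_const|apply is_lim_inv_sqrt].
Qed.

(** * Limits of both sides of the finite identity *)

Definition gauss (d x : R) (n : Z) : R := exp (- (x - IZR n) ^ 2 / d).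

(** Real part of the [theta3] term at [z = PI x], [tau = i PI d]. *)
Definition thetaR (d x : R) (n : Z) : R :=
  exp (- (PI ^ 2 * d * IZR n ^ 2)) * cos (2 * PI * x * IZR n).

Lemma is_lim_Zsum_gauss (d x : R) :
  0 < d -> is_lim_seq (Zsum (gauss d x)) (ZSeries (gauss d x)).
Proof.
intros hd. destruct (is_Zseries_gauss d x hd) as [l1 [l2 [h1 [h2 _]]]].
apply is_lim_seq_Zsum; [now exists l1|now exists l2].
Qed.

Lemma is_lim_Zsum_thetaR (d x : R) :
  0 < d -> is_lim_seq (Zsum (thetaR d x)) (ZSeries (thetaR d x)).
Proof.
intros hd. assert (hp := PI_RGT_0).
destruct (ex_series_Zquad (PI ^ 2 * d) 0 (thetaR d x)) as [h1 h2].
- apply Rmult_lt_0_compat; [now apply pow_lt|exact hd].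
- intros n. unfold thetaR. rewrite Rabs_mult, (Rabs_pos_eq (exp _)) by apply Rlt_le, exp_pos.
  replace (0 * IZR n - PI ^ 2 * d * IZR n ^ 2) with (- (PI ^ 2 * d * IZR n ^ 2)) by ring.
  rewrite <- Rmult_1_r. apply Rmult_le_compat_l; [apply Rlt_le, exp_pos|].
  apply Rabs_le, COS_bound.
- now apply is_lim_seq_Zsum.
Qed.

Lemma ZSeries_ext (f g : Z -> R) : (forall n, f n = g n) -> ZSeries f = ZSeries g.
Proof. intros h. unfold ZSeries. f_equal; apply Series_ext; intros; apply h. Qed.

Lemma gauss_selfdual : ZSeries (gauss (/ PI) 0) = ZSeries (thetaR (/ PI) 0).
Proof.
apply ZSeries_ext. intros n. unfold gauss, thetaR.
replace (2 * PI * 0 * IZR n) with 0 by ring. rewrite cos_0, Rmult_1_r.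
f_equal. field. apply PI_neq0.
Qed.

(** Allows the common limit to be cancelled in [is_lim_wallis]. *)
Lemma ZSeries_gauss_pos (d x : R) : 0 < d -> 0 < ZSeries (gauss d x).
Proof.
intros hd. apply Rlt_le_trans with (gauss d x 0); [apply exp_pos|].
assert (h : Rbar_le (gauss d x 0) (ZSeries (gauss d x))); [|exact h].
apply (is_lim_seq_le (fun _ => gauss d x 0) (Zsum (gauss d x))).
- induction n as [|n IH]; [apply Rle_refl|]. rewrite Zsum_S.
  assert (h1 := exp_pos (- (x - IZR (Z.of_nat (S n))) ^ 2 / d)).
  assert (h2 := exp_pos (- (x - IZR (- Z.of_nat (S n))) ^ 2 / d)).
  unfold gauss in *. lra.
- apply is_lim_seq_const.
- now apply is_lim_Zsum_gauss.
Qed.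

Lemma is_lim_div_sqrt_inv (l : nat -> R) (s : R) :
  0 < s -> is_lim_seq (fun m => l m / sqrt (INR m)) s ->
  is_lim_seq (fun m => sqrt (INR m) / l m) (/ s).
Proof.
intros hs h.
apply is_lim_seq_ext with (fun m => / (l m / sqrt (INR m))).
- intros m. unfold Rdiv. rewrite Rinv_mult, Rinv_inv. ring.
- apply (is_lim_seq_inv _ s); [exact h|]. intros e. injection e. lra.
Qed.

Lemma is_lim_inv_odd (p : nat -> nat) (s : R) :
  0 < s -> is_lim_seq (fun m => INR (2 * p m + 1) / sqrt (INR m)) s ->
  is_lim_seq (fun m => / INR (2 * p m + 1)) 0.
Proof.
intros hs h.
apply is_lim_seq_ext_loc with
  (fun m => sqrt (INR m) / INR (2 * p m + 1) * / sqrt (INR m)).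
- generalize (eventually_ge 1). apply filter_imp. intros m hm.
  assert (0 < sqrt (INR m)) by (apply sqrt_lt_R0, lt_0_INR; lia).
  field. split; [apply not_0_INR; lia|lra].
- replace 0 with (/ s * 0) by ring. apply is_lim_seq_mult'.
  + now apply is_lim_div_sqrt_inv.
  + exact is_lim_inv_sqrt.
Qed.

Lemma eventually_odd_gt (p : nat -> nat) (s c : R) :
  0 < s -> is_lim_seq (fun m => INR (2 * p m + 1) / sqrt (INR m)) s ->
  eventually (fun m => c < INR (2 * p m + 1)).
Proof.
intros hs h.
assert (hc : 0 < / (Rabs c + 1))
  by (apply Rinv_0_lt_compat; assert (h0 := Rabs_pos c); lra).
generalize (eventually_lt _ _ _ (is_lim_inv_odd p s hs h) hc).
apply filter_imp. intros m hm. apply Rinv_lt_cancel in hm.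
- assert (h0 := Rle_abs c). lra.
- apply lt_0_INR. lia.
Qed.

(** Write [l = 2 p + 1] and [u = PI (j - x) / l]. For fixed [j], [m u^2] tends to [(x - j)^2 / d],
    so [is_lim_cos_pow] gives the Gaussian term; a wider Gaussian dominates. *)
Lemma is_lim_cos_side (d x : R) (p : nat -> nat) :
  0 < d ->
  is_lim_seq (fun m => INR (2 * p m + 1) / sqrt (INR m)) (PI * sqrt d) ->
  is_lim_seq (fun m => Zsum (fun j =>
    cos (PI * (IZR j - x) / INR (2 * p m + 1)) ^ (2 * m)) (p m))
    (ZSeries (gauss d x)).
Proof.
intros hd hl. assert (hpi := PI_RGT_0).
assert (hsd : 0 < sqrt d) by now apply sqrt_lt_R0.
set (s := PI * sqrt d) in *.
assert (hs : 0 < s) by (apply Rmult_lt_0_compat; lra).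
assert (hv := is_lim_div_sqrt_inv _ s hs hl).
assert (hmt : forall m j, INR m * (PI * (IZR j - x) / INR (2 * p m + 1)) ^ 2 =
  PI ^ 2 * (x - IZR j) ^ 2 * (sqrt (INR m) / INR (2 * p m + 1)) ^ 2).
{ intros m j. rewrite <- (sqrt_sqrt (INR m)) at 1 by apply pos_INR.
  field. apply not_0_INR. lia. }
(* This is [256 d], with [256 = 4 * 64]: the 4 comes from [sqrt m / l > 1 / (2 s)], the 64 from
   [1 - u^2 / 6 >= 1 / 8], both squared. *)
set (D := 256 * s ^ 2 / PI ^ 2).
assert (hD : 0 < D).
{ apply Rdiv_lt_0_compat; [|now apply pow_lt].
  apply Rmult_lt_0_compat; [lra|now apply pow_lt]. }
apply (Zsum_Tannery
  (fun m j => cos (PI * (IZR j - x) / INR (2 * p m + 1)) ^ (2 * m))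
  (gauss d x) (gauss D x) _ (ZSeries (gauss D x))).
- now apply is_lim_Zsum_gauss.
- now apply is_lim_Zsum_gauss.
- intros N. generalize (eventually_odd_gt p s (INR (2 * N + 1)) hs hl).
  apply filter_imp. intros m hm. apply INR_lt in hm. lia.
- assert (hs2 : / (2 * s) < / s) by (apply Rinv_lt_contravar; nra).
  generalize (filter_and (F := eventually) _ _ (eventually_gt _ _ _ hv hs2)
    (eventually_odd_gt p s (16 * Rabs x) hs hl)).
  apply filter_imp. intros m [h1 h2] j hj. cbv beta.
  rewrite Rabs_pos_eq by (rewrite pow_mult; apply pow_le, pow2_ge_0).
  set (u := PI * (IZR j - x) / INR (2 * p m + 1)).
  assert (hl0 : 0 < INR (2 * p m + 1)) by (apply lt_0_INR; lia).
  (* From [|j| <= l / 2] and [|x| < l / 16] follows [|j - x| <= 9 l / 16]; with the crude [PI <= 4]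
     this yields [|u| <= 9 / 4]. *)
  assert (hu : u ^ 2 <= 81 / 16).
  { assert (hj' : Rabs (IZR j) <= INR (p m))
      by (rewrite <- abs_IZR, INR_IZR_INZ; now apply IZR_le).
    assert (hjx : Rabs (IZR j - x) <= 9 / 16 * INR (2 * p m + 1)).
    { eapply Rle_trans; [apply Rabs_triang|]. rewrite Rabs_Ropp.
      assert (e : INR (2 * p m + 1) = 2 * INR (p m) + 1)
        by (rewrite plus_INR, mult_INR; simpl; ring).
      lra. }
    assert (h4 := PI_4).
    rewrite <- pow2_abs. replace (81 / 16) with ((9 / 4) ^ 2) by field.
    apply pow_incr. split; [apply Rabs_pos|].
    unfold u, Rdiv. rewrite !Rabs_mult, (Rabs_pos_eq PI), Rabs_inv,
      (Rabs_pos_eq (INR _)) by lra.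
    apply (Rmult_le_reg_r (INR (2 * p m + 1))); [exact hl0|].
    rewrite Rmult_assoc, Rinv_l, Rmult_1_r by lra.
    assert (h0 := Rabs_pos (IZR j - x)). nra. }
  eapply Rle_trans; [apply cos_pow_le; lra|]. unfold gauss. apply exp_le.
  unfold u at 1. rewrite hmt.
  replace (- (x - IZR j) ^ 2 / D) with
    (- (PI ^ 2 * (x - IZR j) ^ 2 * (/ (2 * s)) ^ 2 * (1 / 8) ^ 2))
    by (unfold D; field; lra).
  assert (hq : (1 / 8) ^ 2 <= (1 - u ^ 2 / 6) ^ 2) by (apply pow_incr; lra).
  assert (hw : (/ (2 * s)) ^ 2 <= (sqrt (INR m) / INR (2 * p m + 1)) ^ 2).
  { apply pow_incr. split; [apply Rlt_le, Rinv_0_lt_compat|]; lra. }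
  assert (hk : 0 <= PI ^ 2 * (x - IZR j) ^ 2)
    by (apply Rmult_le_pos; apply pow2_ge_0).
  apply Ropp_le_contravar. apply Rmult_le_compat.
  + apply Rmult_le_pos; [exact hk|apply pow2_ge_0].
  + apply pow2_ge_0.
  + now apply Rmult_le_compat_l.
  + exact hq.
- intros j. unfold gauss.
  replace (- (x - IZR j) ^ 2 / d) with (- (PI ^ 2 * (x - IZR j) ^ 2 * (/ s) ^ 2)).
  + apply is_lim_cos_pow.
    * replace 0 with (PI * (IZR j - x) * 0) by ring.
      apply (is_lim_seq_mult' (fun _ => PI * (IZR j - x))); [apply is_lim_seq_const|].
      now apply (is_lim_inv_odd p s).
    * apply is_lim_seq_ext with (1 := fun m => eq_sym (hmt m j)).
      apply is_lim_seq_mult'; [apply is_lim_seq_const|]. now apply is_lim_seq_sq.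
  + rewrite <- (sqrt_sqrt d) at 1 by lra. unfold s. field. lra.
Qed.

(** For fixed [k], [(k l)^2 / m] tends to [k^2 s^2 = PI^2 d k^2], so [is_lim_bwr] produces the theta
    term. *)
Lemma is_lim_bwr_side (d x : R) (p : nat -> nat) :
  0 < d ->
  is_lim_seq (fun m => INR (2 * p m + 1) / sqrt (INR m)) (PI * sqrt d) ->
  is_lim_seq (fun m => Zsum (fun k =>
    bwr m (k * Z.of_nat (2 * p m + 1)) * cos (2 * PI * x * IZR k)) m)
    (ZSeries (thetaR d x)).
Proof.
intros hd hl. assert (hpi := PI_RGT_0).
assert (hsd : 0 < sqrt d) by now apply sqrt_lt_R0.
set (s := PI * sqrt d) in *.
assert (hs : 0 < s) by (apply Rmult_lt_0_compat; lra).
(* Eventually [l / sqrt m > s / 2], hence [(k l)^2 / (2 m) >= k^2 s^2 / 8], and a Gaussian of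
   parameter [8 / s^2] dominates. *)
assert (hD : 0 < 8 / s ^ 2) by (apply Rdiv_lt_0_compat; [lra|now apply pow_lt]).
assert (hr : forall m, INR m = sqrt (INR m) ^ 2)
  by (intros m; rewrite <- (sqrt_sqrt (INR m)) at 1 by apply pos_INR; ring).
apply (Zsum_Tannery
  (fun m k => bwr m (k * Z.of_nat (2 * p m + 1)) * cos (2 * PI * x * IZR k))
  (thetaR d x) (gauss (8 / s ^ 2) 0) _ (ZSeries (gauss (8 / s ^ 2) 0)) (fun m => m)).
- now apply is_lim_Zsum_thetaR.
- now apply is_lim_Zsum_gauss.
- apply eventually_ge.
- generalize (filter_and (F := eventually) _ _ (eventually_gt _ _ (s / 2) hl ltac:(lra)) (eventually_ge 1)).
  apply filter_imp. intros m [h1 hm] k _. cbv beta.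
  rewrite Rabs_mult, (Rabs_pos_eq (bwr _ _)) by apply bwr_ge_0.
  eapply Rle_trans.
  + apply Rmult_le_compat_l; [apply bwr_ge_0|]. apply Rabs_le, COS_bound.
  + rewrite Rmult_1_r. eapply Rle_trans; [apply bwr_le_gauss; lia|].
    apply exp_le. rewrite mult_IZR, <- INR_IZR_INZ.
    assert (hm0 : 0 < sqrt (INR m)) by (apply sqrt_lt_R0, lt_0_INR; lia).
    rewrite (hr m).
    replace ((IZR k * INR (2 * p m + 1)) ^ 2 / (2 * sqrt (INR m) ^ 2))
      with (IZR k ^ 2 / 2 * (INR (2 * p m + 1) / sqrt (INR m)) ^ 2) by (field; lra).
    replace (- (0 - IZR k) ^ 2 / (8 / s ^ 2))
      with (- (IZR k ^ 2 / 2 * (s / 2) ^ 2)) by (field; lra).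
    apply Ropp_le_contravar, Rmult_le_compat_l.
    * assert (h0 := pow2_ge_0 (IZR k)). lra.
    * apply pow_incr. lra.
- intros k. unfold thetaR.
  apply is_lim_seq_mult'; [|apply is_lim_seq_const].
  set (a := Z.abs_nat k).
  assert (ha : INR a ^ 2 = IZR k ^ 2).
  { unfold a. rewrite INR_IZR_INZ, Zabs2Nat.id_abs, abs_IZR. apply pow2_abs. }
  apply is_lim_seq_ext with (fun m => bwr m (Z.of_nat (a * (2 * p m + 1)))).
  { intros m. rewrite (bwr_abs m (k * _)). do 2 f_equal.
    rewrite Zabs2Nat.inj_mul, Zabs2Nat.id. reflexivity. }
  replace (PI ^ 2 * d * IZR k ^ 2) with (INR a ^ 2 * s ^ 2)
    by (rewrite ha; unfold s; rewrite Rpow_mult_distr, pow2_sqrt by lra; ring).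
  apply is_lim_bwr.
  + apply is_lim_seq_ext_loc with
      (fun m => INR a * (INR (2 * p m + 1) / sqrt (INR m) * / sqrt (INR m))).
    * generalize (eventually_ge 1). apply filter_imp. intros m hm.
      assert (hm0 : 0 < sqrt (INR m)) by (apply sqrt_lt_R0, lt_0_INR; lia).
      rewrite mult_INR. rewrite (hr m) at 3. field. lra.
    * replace 0 with (INR a * (s * 0)) by ring.
      apply is_lim_seq_mult'; [apply is_lim_seq_const|].
      apply is_lim_seq_mult'; [exact hl|exact is_lim_inv_sqrt].
  + apply is_lim_seq_ext_loc with
      (fun m => INR a ^ 2 * (INR (2 * p m + 1) / sqrt (INR m)) ^ 2).
    * generalize (eventually_ge 1). apply filter_imp. intros m hm.
      assert (hm0 : 0 < sqrt (INR m)) by (apply sqrt_lt_R0, lt_0_INR; lia).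
      rewrite mult_INR. rewrite (hr m) at 2. field. lra.
    * apply is_lim_seq_mult'; [apply is_lim_seq_const|]. now apply is_lim_seq_sq.
Qed.

(** * The Wallis constant and the theta transformation *)

(** Normalised central binomial coefficient. It involves neither [d] nor [x] nor [p], so a single
    instance of the identity determines its limit for all of them. *)
Definition wallis (m : nat) : R := sqrt (INR m) * bw m 0 / 2 ^ (2 * m).

(** [Zsum_cos_pow] at [t = - PI x / l], divided by [2 ^ (2 m)] and factored so that each factor has
    its own limit. *)
Lemma Zsum_cos_bwr (x : R) (p m : nat) :
  (0 < m)%nat ->
  Zsum (fun j => cos (PI * (IZR j - x) / INR (2 * p + 1)) ^ (2 * m)) p =
  INR (2 * p + 1) / sqrt (INR m) * wallis m *
  Zsum (fun k => bwr m (k * Z.of_nat (2 * p + 1)) * cos (2 * PI * x * IZR k)) m.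
Proof.
intros hm.
assert (hm0 : 0 < sqrt (INR m)) by now apply sqrt_lt_R0, lt_0_INR.
assert (h0 := bw_0_gt_0 m).
assert (h2 : 0 < 2 ^ (2 * m)) by (apply pow_lt; lra).
assert (hl : 0 < INR (2 * p + 1)) by (apply lt_0_INR; lia).
assert (h := Zsum_cos_pow (- (PI * x / INR (2 * p + 1))) p m). cbv zeta in h.
rewrite <- INR_IZR_INZ in h.
apply (Rmult_eq_reg_l (2 ^ (2 * m))); [|lra].
rewrite <- Zsum_scal.
transitivity (INR (2 * p + 1) * (bw m 0 * Zsum (fun k =>
  bwr m (k * Z.of_nat (2 * p + 1)) * cos (2 * PI * x * IZR k)) m)).
- rewrite <- Zsum_scal. etransitivity; [|etransitivity; [exact h|]].
  + apply Zsum_ext. intros j _. rewrite <- Rpow_mult_distr. do 3 f_equal. field. lra.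
  + f_equal. apply Zsum_ext. intros k _. unfold bwr.
    rewrite <- (cos_neg (2 * PI * x * IZR k)).
    replace (2 * IZR (k * Z.of_nat (2 * p + 1)) * - (PI * x / INR (2 * p + 1)))
      with (- (2 * PI * x * IZR k)); [field; lra|].
    rewrite mult_IZR, <- INR_IZR_INZ. field. lra.
- unfold wallis. field. lra.
Qed.

(** The case [d = 1 / PI], [x = 0], in which the theta and Gaussian series agree
    term by term, supplies the constant that Wallis' product would give. *)
Lemma is_lim_wallis : is_lim_seq wallis (/ sqrt PI).
Proof.
assert (hpi := PI_RGT_0).
assert (hd : 0 < / PI) by now apply Rinv_0_lt_compat.
assert (hsp : 0 < sqrt PI) by now apply sqrt_lt_R0.
assert (hs : PI * sqrt (/ PI) = sqrt PI).
{ rewrite sqrt_inv. rewrite <- (sqrt_sqrt PI) at 1 by lra. field. lra. }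
destruct (odd_approx (PI * sqrt (/ PI))) as [p hp]; [lra|].
assert (hL := is_lim_cos_side (/ PI) 0 p hd hp).
assert (hR := is_lim_bwr_side (/ PI) 0 p hd hp).
assert (hT := ZSeries_gauss_pos (/ PI) 0 hd).
rewrite <- gauss_selfdual in hR. rewrite hs in hp.
set (T := ZSeries (gauss (/ PI) 0)) in *.
(* The quotient of the two sides isolates [wallis m]; by self-duality both sums have the same limit
   [T], which cancels. *)
assert (hq := is_lim_seq_div' _ _ _ _ hL (is_lim_seq_mult' _ _ _ _ hp hR)
  ltac:(nra)).
replace (/ sqrt PI) with (T / (sqrt PI * T)) by (field; lra).
revert hq. apply is_lim_seq_ext_loc.
generalize (filter_and (F := eventually) _ _ (eventually_gt _ _ 0 hR hT) (eventually_ge 1)).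
apply filter_imp. intros m [h1 hm]. rewrite Zsum_cos_bwr by lia.
field. repeat split; [apply Rgt_not_eq, sqrt_lt_R0, lt_0_INR; lia|apply Rgt_not_eq, h1|apply not_0_INR; lia].
Qed.

(** Uniqueness of limits: the prefactor tends to [PI sqrt d / sqrt PI = sqrt (PI d)]. *)
Lemma gauss_theta_duality (d x : R) :
  0 < d -> ZSeries (gauss d x) = sqrt (PI * d) * ZSeries (thetaR d x).
Proof.
intros hd. assert (hpi := PI_RGT_0).
assert (hs : 0 < PI * sqrt d) by (apply Rmult_lt_0_compat; [lra|now apply sqrt_lt_R0]).
destruct (odd_approx _ hs) as [p hp].
assert (hL := is_lim_cos_side d x p hd hp).
assert (hR := is_lim_seq_mult' _ _ _ _ (is_lim_seq_mult' _ _ _ _ hp is_lim_wallis)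
  (is_lim_bwr_side d x p hd hp)).
apply (is_lim_seq_ext_loc _ (fun m => Zsum (fun j =>
  cos (PI * (IZR j - x) / INR (2 * p m + 1)) ^ (2 * m)) (p m))) in hR.
- apply is_lim_seq_unique in hL, hR. rewrite hL in hR. injection hR as e.
  rewrite e, sqrt_mult by lra. f_equal.
  rewrite <- (sqrt_sqrt PI) at 1 by lra. field.
  apply Rgt_not_eq, sqrt_lt_R0, hpi.
- generalize (eventually_ge 1). apply filter_imp. intros m hm.
  symmetry. apply Zsum_cos_bwr. lia.
Qed.

(** * The theta function on the imaginary axis and the [csch] estimate *)

(** The imaginary parts are odd in [n], so all their symmetric partial sums vanish. *)
Lemma theta3_imag_axis (d x : R) :
  0 < d ->
  theta3 (RtoC (PI * x)) (Ci * RtoC (PI * d))%C = RtoC (ZSeries (thetaR d x)).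
Proof.
intros hd.
assert (hRe : forall n, Re (theta3_term (RtoC (PI * x)) (Ci * RtoC (PI * d))%C n) =
  thetaR d x n).
{ intros n. unfold theta3_term, Cexp, thetaR. simpl. f_equal; f_equal; ring. }
assert (hIm : forall n, Im (theta3_term (RtoC (PI * x)) (Ci * RtoC (PI * d))%C n) =
  exp (- (PI ^ 2 * d * IZR n ^ 2)) * sin (2 * PI * x * IZR n)).
{ intros n. unfold theta3_term, Cexp. simpl. f_equal; f_equal; ring. }
unfold theta3, CZSeries. rewrite (ZSeries_ext _ _ hRe), (ZSeries_ext _ _ hIm).
unfold RtoC. f_equal.
set (f := fun n : Z => exp (- (PI ^ 2 * d * IZR n ^ 2)) * sin (2 * PI * x * IZR n)).
assert (hodd : forall n, f (- n)%Z = - f n).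
{ intros n. unfold f. rewrite opp_IZR.
  replace (2 * PI * x * - IZR n) with (- (2 * PI * x * IZR n)) by ring.
  rewrite sin_neg. replace ((- IZR n) ^ 2) with (IZR n ^ 2) by ring. ring. }
assert (hlim : is_lim_seq (Zsum f) (ZSeries f)).
{ assert (hp := PI_RGT_0).
  destruct (ex_series_Zquad (PI ^ 2 * d) 0 f) as [h1 h2].
  - apply Rmult_lt_0_compat; [now apply pow_lt|exact hd].
  - intros n. unfold f. rewrite Rabs_mult, (Rabs_pos_eq (exp _)) by apply Rlt_le, exp_pos.
    replace (0 * IZR n - PI ^ 2 * d * IZR n ^ 2) with (- (PI ^ 2 * d * IZR n ^ 2)) by ring.
    rewrite <- Rmult_1_r. apply Rmult_le_compat_l; [apply Rlt_le, exp_pos|].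
    apply Rabs_le, SIN_bound.
  - now apply is_lim_seq_Zsum. }
apply (is_lim_seq_ext _ (fun _ => 0)) in hlim; [|intros N; now apply Zsum_odd].
apply is_lim_seq_unique in hlim. rewrite Lim_seq_const in hlim.
now injection hlim.
Qed.

Lemma pow_le_pow_of_le (q : R) (m n : nat) :
  0 <= q <= 1 -> (m <= n)%nat -> q ^ n <= q ^ m.
Proof.
intros hq h. replace n with (m + (n - m))%nat by lia. rewrite pow_add.
rewrite <- (Rmult_1_r (q ^ m)) at 2. apply Rmult_le_compat_l; [now apply pow_le|].
rewrite <- (pow1 (n - m)). now apply pow_incr.
Qed.

Lemma thetaR_abs_le (d x : R) (n : Z) (k : nat) :
  0 < d -> Z.abs_nat n = k -> Rabs (thetaR d x n) <= exp (- (PI ^ 2 * d)) ^ (k * k).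
Proof.
intros hd <-. rewrite exp_pow, mult_INR, INR_IZR_INZ, Zabs2Nat.id_abs, abs_IZR.
replace (Rabs (IZR n) * Rabs (IZR n)) with (IZR n ^ 2) by (rewrite <- pow2_abs; ring).
unfold thetaR. rewrite Rabs_mult, (Rabs_pos_eq (exp _)) by apply Rlt_le, exp_pos.
replace (IZR n ^ 2 * - (PI ^ 2 * d)) with (- (PI ^ 2 * d * IZR n ^ 2)) by ring.
rewrite <- Rmult_1_r. apply Rmult_le_compat_l; [apply Rlt_le, exp_pos|].
apply Rabs_le, COS_bound.
Qed.

(** The quotient is the partial sum of [2 q ^ (2 n - 1)], which for infinite [N]
    is the hyperbolic cosecant; [2 (q ^ 3 - q ^ 4)] is the gain of the term
    [n = 2], where [n ^ 2 > 2 n - 1]. *)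
Lemma Zsum_thetaR_bound (d x : R) (N : nat) :
  let q := exp (- (PI ^ 2 * d)) in
  0 < d ->
  Rabs (Zsum (thetaR d x) (S (S N)) - 1) <=
  2 * q * (1 - q ^ (2 * S (S N))) / (1 - q ^ 2) - 2 * (q ^ 3 - q ^ 4).
Proof.
intros q hd.
assert (hq : 0 < q < 1).
{ split; [apply exp_pos|]. rewrite <- exp_0. apply exp_increasing.
  assert (0 < PI ^ 2 * d); [|lra].
  apply Rmult_lt_0_compat; [apply pow_lt, PI_RGT_0|exact hd]. }
assert (hq2 : 1 - q ^ 2 <> 0) by nra.
assert (hz : thetaR d x 0 = 1).
{ unfold thetaR. rewrite !Rmult_0_r, cos_0, pow_i, Rmult_0_r, Ropp_0, exp_0 by lia. ring. }
induction N as [|N IH].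
- rewrite !Zsum_S. change (Zsum (thetaR d x) 0) with (thetaR d x 0). rewrite hz.
  assert (h1 := thetaR_abs_le d x (Z.of_nat 1) 1 hd eq_refl).
  assert (h2 := thetaR_abs_le d x (- Z.of_nat 1) 1 hd eq_refl).
  assert (h3 := thetaR_abs_le d x (Z.of_nat 2) 2 hd eq_refl).
  assert (h4 := thetaR_abs_le d x (- Z.of_nat 2) 2 hd eq_refl).
  fold q in h1, h2, h3, h4.
  replace (q ^ (1 * 1)) with q in * by (simpl; ring).
  replace (q ^ (2 * 2)) with (q ^ 4) in * by (simpl; ring).
  apply Rabs_le_between in h1, h2, h3, h4.
  replace (2 * q * (1 - q ^ 4) / (1 - q ^ 2) - 2 * (q ^ 3 - q ^ 4))
    with (2 * q + 2 * q ^ 4) by (field; exact hq2).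
  apply Rabs_le_between. lra.
- rewrite Zsum_S. set (k := S (S (S N))) in *.
  assert (h1 := thetaR_abs_le d x (Z.of_nat k) k hd ltac:(lia)).
  assert (h2 := thetaR_abs_le d x (- Z.of_nat k) k hd ltac:(lia)).
  fold q in h1, h2.
  (* This is [k^2 >= 2 k - 1], where [2 k - 1 = 2 * S (S N) + 1]. *)
  assert (h3 := pow_le_pow_of_le q (2 * S (S N) + 1) (k * k) ltac:(lra) ltac:(unfold k; nia)).
  rewrite pow_add, pow_1 in h3.
  replace (2 * k)%nat with (2 * S (S N) + 2)%nat by (unfold k; lia).
  rewrite pow_add. set (Q := q ^ (2 * S (S N))) in *.
  replace (2 * q * (1 - Q * q ^ 2) / (1 - q ^ 2))
    with (2 * q * (1 - Q) / (1 - q ^ 2) + 2 * (Q * q)) by (field; exact hq2).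
  apply Rabs_le_between in IH, h1, h2. apply Rabs_le_between. lra.
Qed.

Lemma csch_exp (t : R) : 0 < t -> csch t = 2 * exp (- t) / (1 - exp (- t) ^ 2).
Proof.
intros ht. unfold csch, sinh. assert (h0 := exp_pos t).
assert (h1 : 1 < exp t) by (rewrite <- exp_0; now apply exp_increasing).
rewrite exp_Ropp. field. split; nra.
Qed.

Lemma ZSeries_thetaR_lt (d x : R) :
  0 < d -> Rabs (ZSeries (thetaR d x) - 1) < csch (PI ^ 2 * d).
Proof.
intros hd.
assert (ht : 0 < PI ^ 2 * d)
  by (apply Rmult_lt_0_compat; [apply pow_lt, PI_RGT_0|exact hd]).
rewrite csch_exp by exact ht. set (q := exp (- (PI ^ 2 * d))).
assert (hq : 0 < q < 1).
{ split; [apply exp_pos|]. rewrite <- exp_0. apply exp_increasing. lra. }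
(* Only a weak inequality survives the limit; the gap [2 (q^3 - q^4) > 0], uniform in [N], restores
   strictness. *)
apply Rle_lt_trans with (2 * q / (1 - q ^ 2) - 2 * (q ^ 3 - q ^ 4)).
- assert (h : Rbar_le (Rabs (ZSeries (thetaR d x) - 1))
    (2 * q / (1 - q ^ 2) - 2 * (q ^ 3 - q ^ 4))); [|exact h].
  apply (is_lim_seq_le (fun N => Rabs (Zsum (thetaR d x) (S (S N)) - 1))
    (fun _ => 2 * q / (1 - q ^ 2) - 2 * (q ^ 3 - q ^ 4))).
  + intros N. eapply Rle_trans; [now apply Zsum_thetaR_bound|]. fold q.
    apply Rplus_le_compat_r. apply Rmult_le_compat_r.
    * apply Rlt_le, Rinv_0_lt_compat. nra.
    * assert (0 < q ^ (2 * S (S N))) by (apply pow_lt; lra). nra.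
  + apply (is_lim_seq_abs _ (ZSeries (thetaR d x) - 1)).
    apply is_lim_seq_minus'; [|apply is_lim_seq_const].
    apply (is_lim_seq_incr_1 (fun N => Zsum (thetaR d x) (S N))).
    apply (is_lim_seq_incr_1 (Zsum (thetaR d x))).
    now apply is_lim_Zsum_thetaR.
  + apply is_lim_seq_const.
- assert (0 < q ^ 3) by (apply pow_lt; lra).
  replace (q ^ 4) with (q ^ 3 * q) by ring. nra.
Qed.

Theorem theorem2p2 :
  forall d : R, 0 < d ->
  forall x : R,
    Rabs (1 / sqrt (PI * d) * ZSeries (fun n : Z => exp (- (x - IZR n) ^ 2 / d)) - 1)
      = Cmod (theta3 (RtoC (PI * x)) (Ci * RtoC (PI * d))%C - RtoC 1)%C
    /\
    Cmod (theta3 (RtoC (PI * x)) (Ci * RtoC (PI * d))%C - RtoC 1)%C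
      < csch (PI ^ 2 * d).
Proof.
intros d hd x. rewrite theta3_imag_axis by exact hd.
rewrite <- RtoC_minus, Cmod_R. split; [|now apply ZSeries_thetaR_lt].
change (fun n : Z => exp (- (x - IZR n) ^ 2 / d)) with (gauss d x).
rewrite gauss_theta_duality by exact hd. do 2 f_equal. field.
apply Rgt_not_eq, sqrt_lt_R0, Rmult_lt_0_compat; [apply PI_RGT_0|exact hd].
Qed.
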